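(* Let $X$ be a proper, connected, and inversion invariant bi-Lipschitz homogeneous metric space. Then $X$ is quasi-self-similar.
   Context: A metric space $(X,d)$ is proper if closed balls are compact. A homeomorphism $f$ between metric spaces is $L$-bi-Lipschitz ($1\le L<\infty$) if $L^{-1}d(x,y)\le d(f(x),f(y))\le L\,d(x,y)$ for all $x,y$. Metric inversion. Let $\hat X=X\cup\{\infty\}$. For $p\in X$ write $X_p=X\setminus\{p\}$, $\hat X_p=\hat X\setminus\{p\}$, and for $x,y\in X_p$ set $$i_p(x,y)=\frac{d(x,y)}{d(x,p)d(y,p)},\qquad i_p(x,\infty)=i_p(\infty,x)=\frac1{d(x,p)},\qquad i_p(\infty,\infty)=0.$$ Let $d_p(x,y)=\inf\sum_{i=0}^{k-1}i_p(x_i,x_{i+1})$, the infimum over all finite chains $x=x_0,x_1,\dots,x_k=y$ in $\hat X_p$. This is a metric on $\hat X_p$ with $\frac14 i_p\le d_p\le i_p$. The metric inversion of $X$ at $p$ is $X_p^*=(\hat X_p,d_p)$. A metric space $Z$ is uniformly bi-Lipschitz homogeneous if there is $1\le L<\infty$ such that for all $x,y\in Z$ there is an $L$-bi-Lipschitz self-homeomorphism $f$ of $Z$ with $f(x)=y$ (no group structure is required). $X$ is inversion invariant bi-Lipschitz homogeneous if both $X$ and $X_p^*$ are uniformly bi-Lipschitz homogeneous, for some $p\in X$; this does not depend on $p$. $(X,d)$ is quasi-self-similar if there are $1\le L<\infty$ and a point $x\in X$ such that for every $s\ge1$ there is an $L$-bi-Lipschitz homeomorphism $f_s:(X,sd)\to(X,d)$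 with $f_s(x)=x$ ($L$ does not depend on $s$). *)

(* Defs.v *)
From HB Require Import structures.
From mathcomp Require Import all_boot all_order all_algebra.
From mathcomp Require Import all_classical all_reals all_analysis.
From mathcomp Require Import ring lra.

Set Implicit Arguments.
Unset Strict Implicit.
Unset Printing Implicit Defensive.

Import Order.TTheory GRing.Theory Num.Theory.

Local Open Scope classical_set_scope.
Local Open Scope ring_scope.

(* The library's [closed_ball] is the closure of the open ball, which may be
   smaller than the closed ball used here. *)
Definition proper_metric (R : realType) (X : metricType R) : Prop :=
  forall (x : X) (r : R), compact [set y : X | mdist x y <= r].

Definition homeomorphism (X Y : topologicalType) (f : X -> Y) : Prop :=
  continuous f /\ exists g : Y -> X, [/\ cancel f g, cancel g f & continuous g].

Definition bilipschitz_homeo (R : realType) (X Y : metricType R) (L : R)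
    (f : X -> Y) : Prop :=
  homeomorphism f /\
  forall x y : X,
    L^-1 * mdist x y <= mdist (f x) (f y) /\
    mdist (f x) (f y) <= L * mdist x y.

Definition uniformly_bilipschitz_homogeneous (R : realType)
    (Z : metricType R) : Prop :=
  exists2 L : R, 1 <= L &
    forall x y : Z, exists2 f : Z -> Z, bilipschitz_homeo L f & f x = y.

(* The metric space (X, s d). *)
Definition rescaled (R : realType) (X : metricType R) (s : {posnum R}) : Type :=
  X.

Section Rescaled.
Context (R : realType) (X : metricType R) (s : {posnum R}).

Definition rescaled_dist (x y : rescaled X s) : R :=
  s%:num * mdist (x : X) (y : X).

Lemma rescaled_distxx x : rescaled_dist x x = 0.
Proof. by rewrite /rescaled_dist mdistxx mulr0. Qed.

Lemma rescaled_dist_eq0 x y : rescaled_dist x y = 0 -> x = y.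
Proof.
move=> /eqP; rewrite mulf_eq0 gt_eqF//= => /eqP.
exact: mdist_positivity.
Qed.

Lemma rescaled_distC x y : rescaled_dist x y = rescaled_dist y x.
Proof. by rewrite /rescaled_dist metric_sym. Qed.

Lemma rescaled_dist_triangle y x z :
  rescaled_dist x z <= rescaled_dist x y + rescaled_dist y z.
Proof. by rewrite -mulrDr ler_pM2l// metric_triangle. Qed.

HB.instance Definition _ := Choice.copy (rescaled X s) X.
HB.instance Definition _ := isMetric.Build R (rescaled X s)
  rescaled_distxx rescaled_dist_eq0 rescaled_distC rescaled_dist_triangle.

End Rescaled.

Definition quasi_self_similar (R : realType) (X : metricType R) : Prop :=
  exists2 L : R, 1 <= L &
    exists x : X, forall s : {posnum R}, 1 <= s%:num ->
      exists2 f : rescaled X s -> X, bilipschitz_homeo L f & f x = x.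

(* The one-point extension of X is [option X], with [None] the point at
   infinity. *)
Definition inversion (R : realType) (X : metricType R) (p : X) : Type :=
  {z : option X | z != Some p}.

Section Inversion.
Context (R : realType) (X : metricType R) (p : X).

(* Also defined, with junk value 0, when an argument is [Some p]. *)
Definition inversion_weight (x y : option X) : R :=
  match x, y with
  | Some a, Some b => mdist a b / (mdist a p * mdist b p)
  | Some a, None | None, Some a => (mdist a p)^-1
  | None, None => 0
  end.

Definition chain_length (k : nat) (c : nat -> inversion p) : R :=
  \sum_(0 <= i < k) inversion_weight (val (c i)) (val (c i.+1)).

Definition inversion_dist (x y : inversion p) : R :=
  inf [set l | exists k (c : nat -> inversion p),
         [/\ c 0%N = x, c k = y & l = chain_length k c]].

Local Notation iw := inversion_weight.

Let u (x : option X) : R := if x is Some a then (mdist a p)^-1 else 0.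

Let uge0 x : 0 <= u x.
Proof. by case: x => //= a; rewrite invr_ge0 mdist_ge0. Qed.

Lemma inversion_weightC x y : iw x y = iw y x.
Proof.
by case: x y => [a|] [b|] //=; rewrite metric_sym [in X in _ / X]mulrC.
Qed.

Lemma inversion_weight_ge0 x y : 0 <= iw x y.
Proof.
by case: x y => [a|] [b|] //=;
  rewrite ?divr_ge0 ?mulr_ge0 ?invr_ge0 ?mdist_ge0.
Qed.

Lemma inversion_weightxx x : iw x x = 0.
Proof. by case: x => //= a; rewrite mdistxx mul0r. Qed.

Let dp_gt0 a : Some a != Some p -> 0 < mdist a p.
Proof. by rewrite mdist_gt0; apply: contra_neq => ->. Qed.

Let weight_lip x y : x != Some p -> y != Some p -> u x <= u y + iw x y.
Proof.
case: x y => [a|] [b|] //= ha hb; rewrite ?add0r ?addr0 ?addr_ge0 ?invr_ge0 ?mdist_ge0//.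
have a0 := dp_gt0 ha; have b0 := dp_gt0 hb.
have -> : (mdist a p)^-1 = mdist b p / (mdist a p * mdist b p).
  by field; rewrite !gt_eqF.
have -> : (mdist b p)^-1 = mdist a p / (mdist a p * mdist b p).
  by field; rewrite !gt_eqF.
rewrite -mulrDl ler_pM2r ?invr_gt0 ?mulr_gt0//.
by rewrite addrC (metric_sym a b) metric_triangle.
Qed.

Let weight_ub x y : x != Some p -> y != Some p -> iw x y <= u x + u y.
Proof.
case: x y => [a|] [b|] //= ha hb; rewrite ?add0r ?addr0//.
have a0 := dp_gt0 ha; have b0 := dp_gt0 hb.
have -> : (mdist a p)^-1 + (mdist b p)^-1 =
    (mdist a p + mdist b p) / (mdist a p * mdist b p).
  by field; rewrite !gt_eqF.
rewrite ler_pM2r ?invr_gt0 ?mulr_gt0//.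
by rewrite (metric_sym b p) metric_triangle.
Qed.

Lemma chain_length_ge0 k c : 0 <= chain_length k c.
Proof. by apply: sumr_ge0 => i _; exact: inversion_weight_ge0. Qed.

Let chain_lip k c : u (val (c 0%N)) <= u (val (c k)) + chain_length k c.
Proof.
rewrite /chain_length; elim: k => [|k IH]; first by rewrite big_geq// addr0.
rewrite big_nat_recr//=.
have := weight_lip (valP (c k)) (valP (c k.+1)).
lra.
Qed.

Let chain_lower k (c : nat -> inversion p) (t : R) a b : 0 < t ->
  (forall i, (i <= k)%N -> t <= u (val (c i))) ->
  val (c 0%N) = Some a -> val (c k) = Some b ->
  t ^+ 2 * mdist a b <= chain_length k c.
Proof.
move=> t0; rewrite /chain_length; elim: k b => [|k IH] b tu ca cb.
  by move: cb; rewrite big_geq// ca => -[<-]; rewrite mdistxx mulr0.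
rewrite big_nat_recr//.
have := tu k (leqnSn k); case ck : (val (c k)) => [e|]; last first.
  by rewrite leNgt t0.
rewrite /= => te; have tb := tu k.+1 (leqnn _); rewrite cb/= in tb.
have {}IH := IH e (fun i ik => tu i (leqW ik)) ca ck.
rewrite cb.
have : t ^+ 2 * mdist e b <= mdist e b / (mdist e p * mdist b p).
  rewrite mulrC ler_wpM2l ?mdist_ge0// invfM expr2.
  by rewrite ler_pM// ltW.
move=> eb; apply: le_trans (lerD IH eb).
by rewrite -mulrDr ler_pM2l ?exprn_gt0// metric_triangle.
Qed.

Let chain_weight_le k c : u (val (c k)) <= u (val (c 0%N)) ->
  iw (val (c 0%N)) (val (c k)) / 4 <= chain_length k c.
Proof.
move=> ule; pose S := chain_length k c; pose t := u (val (c 0%N)) / 2.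
have wub := weight_ub (valP (c 0%N)) (valP (c k)).
rewrite -/S; have [tS|St] := leP t S.
  apply: le_trans tS; rewrite /t; lra.
have S0 : 0 <= S by exact: chain_length_ge0.
have t0 : 0 < t by exact: le_lt_trans S0 St.
have tu i : (i <= k)%N -> t <= u (val (c i)).
  move=> ik; have ci := chain_lip i c.
  have cS : chain_length i c <= S.
    rewrite /S /chain_length (big_cat_nat (leq0n _) ik)//= lerDl.
    by apply: sumr_ge0 => j _; exact: inversion_weight_ge0.
  rewrite /t in St *; lra.
have := tu 0%N isT; case c0 : (val (c 0%N)) => [a|]; last by rewrite leNgt t0.
have := tu k (leqnn k); case ck : (val (c k)) => [b|]; last by rewrite leNgt t0.
move=> tb ta; apply: le_trans (chain_lower t0 tu c0 ck).
move: ule; rewrite /t c0 ck /= => ule.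
have -> : mdist a b / (mdist a p * mdist b p) / 4 =
    ((mdist a p)^-1 * (mdist b p)^-1 / 4) * mdist a b by rewrite invfM; ring.
rewrite ler_wpM2r ?mdist_ge0// expr_div_n expr2.
have -> : 2 ^+ 2 = 4 :> R by ring.
by rewrite ler_pM2r ?invr_gt0// ler_wpM2l// invr_ge0 mdist_ge0.
Qed.

Definition chain_rev (k : nat) (c : nat -> inversion p) : nat -> inversion p :=
  fun i => c (k - i)%N.

Lemma chain_length_rev k c : chain_length k (chain_rev k c) = chain_length k c.
Proof.
rewrite /chain_length [RHS]big_nat_rev/= big_nat_cond [RHS]big_nat_cond.
apply: eq_bigr => i /andP[/andP[_ ik] _].
by rewrite /chain_rev add0n subnS prednK ?subn_gt0// inversion_weightC.
Qed.

Lemma chain_length_ge k c :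
  iw (val (c 0%N)) (val (c k)) / 4 <= chain_length k c.
Proof.
have [/chain_weight_le//|/ltW cu] := leP (u (val (c k))) (u (val (c 0%N))).
have := @chain_weight_le k (chain_rev k c).
rewrite chain_length_rev /chain_rev subnn subn0 inversion_weightC.
exact.
Qed.

Local Notation chains x y := [set l | exists k (c : nat -> inversion p),
  [/\ c 0%N = x, c k = y & l = chain_length k c]].

Let chains_weight x y : chains x y (iw (val x) (val y)).
Proof.
exists 1%N, (fun i => if i is 0%N then x else y); split => //.
by rewrite /chain_length big_nat1.
Qed.

Let chains_lb x y : lbound (chains x y) (iw (val x) (val y) / 4).
Proof. by move=> _ [k [c [<- <- ->]]]; exact: chain_length_ge. Qed.

Let chains_inf x y : has_inf (chains x y).
Proof. by split; [eexists; exact: chains_weight|eexists; exact: chains_lb]. Qed.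

Lemma inversion_dist_le x y :
  inversion_dist x y <= iw (val x) (val y).
Proof. by apply: ge_inf; [case: (chains_inf x y)|exact: chains_weight]. Qed.

Lemma inversion_dist_ge x y :
  iw (val x) (val y) / 4 <= inversion_dist x y.
Proof. by apply: lb_le_inf; [case: (chains_inf x y)|exact: chains_lb]. Qed.

Lemma inversion_distxx x : inversion_dist x x = 0.
Proof.
apply/le_anti/andP; split.
  by rewrite -(inversion_weightxx (val x)) inversion_dist_le.
by apply: le_trans (inversion_dist_ge x x); rewrite inversion_weightxx mul0r.
Qed.

Lemma inversion_dist_eq0 x y : inversion_dist x y = 0 -> x = y.
Proof.
move=> xy; have := inversion_dist_ge x y; rewrite xy pmulr_lle0 ?invr_gt0//.
move=> w0; apply: val_inj; have {w0} : iw (val x) (val y) = 0.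
  by apply/le_anti; rewrite w0 inversion_weight_ge0.
have := valP x; have := valP y.
case: (val x) (val y) => [a|] [b|] //= hb ha /eqP.
- rewrite mulf_eq0 invr_eq0 mulf_eq0 !(gt_eqF (dp_gt0 _))// !orbF.
  by move=> /eqP/mdist_positivity ->.
- by rewrite invr_eq0 gt_eqF ?dp_gt0.
- by rewrite invr_eq0 gt_eqF ?dp_gt0.
Qed.

Let inversion_dist_sym_le x y : inversion_dist x y <= inversion_dist y x.
Proof.
apply: lb_le_inf; first by case: (chains_inf y x).
move=> _ [k [c [<- <- ->]]]; apply: ge_inf; first by case: (chains_inf (c k) (c 0%N)).
exists k, (chain_rev k c).
by rewrite chain_length_rev /chain_rev subnn subn0; split.
Qed.

Lemma inversion_distC x y : inversion_dist x y = inversion_dist y x.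
Proof. by apply/le_anti; rewrite !inversion_dist_sym_le. Qed.

Lemma inversion_dist_triangle y x z :
  inversion_dist x z <= inversion_dist x y + inversion_dist y z.
Proof.
rewrite -lerBlDr; apply: lb_le_inf; first by case: (chains_inf x y).
move=> _ [k [c [cx cy ->]]]; rewrite lerBlDr -lerBlDl.
apply: lb_le_inf; first by case: (chains_inf y z).
move=> _ [m [e [ey ez ->]]]; rewrite lerBlDl.
apply: ge_inf; first by case: (chains_inf x z).
exists (k + m)%N, (fun i => if (i <= k)%N then c i else e (i - k)%N); split => //.
- case: m ez => [|m] ez; first by rewrite addn0 leqnn cy -ey.
  by rewrite leqNgt addnS ltnS leq_addr/= -addnS addKn.
- rewrite /chain_length (big_cat_nat (leq0n _) (leq_addr m k))/=; congr (_ + _).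
    rewrite big_nat_cond [RHS]big_nat_cond; apply: eq_bigr => i.
    by move=> /andP[/andP[_ ik] _]; rewrite ik (ltnW ik).
  rewrite -{1}[k]add0n big_addn addKn; apply: eq_bigr => i _.
  have ltk j : (j.+1 + k <= k)%N = false by rewrite leqNgt addSn ltnS leq_addl.
  rewrite -addSn ltk !addnK.
  case: i => [|i]; first by rewrite add0n leqnn cy ey.
  by rewrite ltk.
Qed.

HB.instance Definition _ := Choice.on (inversion p).
HB.instance Definition _ := isMetric.Build R (inversion p)
  inversion_distxx inversion_dist_eq0 inversion_distC inversion_dist_triangle.

End Inversion.

Definition inversion_invariant_bilipschitz_homogeneous (R : realType)
    (X : metricType R) : Prop :=
  uniformly_bilipschitz_homogeneous X /\
  exists p : X, uniformly_bilipschitz_homogeneous (inversion p : metricType R).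

(* Main.v *)
Require Import Defs.
From mathcomp Require Import all_boot all_order all_algebra.
From mathcomp Require Import all_classical all_reals all_analysis.
From mathcomp Require Import ring lra.

Local Open Scope classical_set_scope.
Local Open Scope ring_scope.

Set Implicit Arguments.
Unset Strict Implicit.
Unset Printing Implicit Defensive.

Import Order.TTheory GRing.Theory Num.Theory.

(** Inverting twice gives back the original space, but the scale of the result
    depends on where the second inversion is centred, and this is what makes
    [X] self-similar.

    Let [i_p] be the weight defining the inversion [X_p^*]. Inverting [X_p^*]
    again at infinity gives, up to a bounded factor, the distance [d] of [X],
    while inverting it at a point [q] of [X] gives [d(q,p)^2 i_q]
    ([reinversion_at_infty], [reinversion_at_point]). An [L]-bi-Lipschitz map
    [g] of [X_p^*] with [g(oo) = q], extended by sending [p], the point at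
    infinity of [X_p^*], to itself, changes the weights of the second inversion
    by at most [L^3] ([inversion_weight_distortion]). Hence [X] is bi-Lipschitz
    equivalent to [X_q^*] with metric multiplied by [d(q,p)^2]. Moving [q] back
    to [p] by homogeneity of [X], we see that [X] is bi-Lipschitz equivalent to
    [X_p^*] with metric multiplied by [r^2], with a constant that does not
    depend on [r = d(q,p)] ([inversion_chart_exists]).

    Two such equivalences, for the radii [r0] and [r0 / sqrt s], compose to a
    self-map of [X] which multiplies distances by about [s]
    ([inversion_charts_rescale]). If [X] has a point at distance [r0 > 0] from
    [p], connectedness provides a point [q] at every distance from [p] between
    [0] and [r0] ([connected_dist_attained]), so all [s >= 1] are obtained.
    Homogeneity of [X] then puts the base point back in place. If [X] is a
    single point, the identity does. *)

(** * Comparison up to a factor *)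

Definition within_factor (R : realType) (K a b : R) : Prop :=
  a <= K * b /\ b <= K * a.

Section WithinFactor.
Context (R : realType).
Implicit Types K M a b c d : R.

Lemma within_factor_sym K a b : within_factor K a b -> within_factor K b a.
Proof. by case. Qed.

Lemma within_factor_trans K M a b c : 0 <= K -> 0 <= M ->
  within_factor K a b -> within_factor M b c -> within_factor (K * M) a c.
Proof.
move=> K0 M0 [ab ba] [bc cb]; split.
  by apply: le_trans ab _; rewrite -mulrA ler_wpM2l.
by apply: le_trans cb _; rewrite [K * M]mulrC -mulrA ler_wpM2l.
Qed.

Lemma within_factor_le K M a b : 0 <= a -> 0 <= b -> K <= M ->
  within_factor K a b -> within_factor M a b.
Proof.
by move=> a0 b0 KM [ab ba]; split; [apply: le_trans ab _|apply: le_trans ba _];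
  rewrite ler_wpM2r.
Qed.

Lemma within_factorM K M a b c d : 0 <= a -> 0 <= b -> 0 <= c -> 0 <= d ->
  within_factor K a b -> within_factor M c d ->
  within_factor (K * M) (a * c) (b * d).
Proof. by move=> a0 b0 c0 d0 [? ?] [? ?]; split; rewrite mulrACA ler_pM. Qed.

Lemma within_factorZ K c a b : 0 <= c ->
  within_factor K a b -> within_factor K (c * a) (c * b).
Proof. by move=> c0 [ab ba]; split; rewrite mulrCA ler_wpM2l. Qed.

(** Inverses of 0 cause no trouble: [a] and [b] vanish together, and then so do
    their inverses. *)
Lemma within_factorV K a b : 0 < K -> 0 <= a -> 0 <= b ->
  within_factor K a b -> within_factor K a^-1 b^-1.
Proof.
move=> K0; have half x y : 0 <= x -> 0 <= y -> within_factor K x y ->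
    x^-1 <= K * y^-1.
  rewrite le0r => /predU1P[->|x0] y0 [xy yx].
    by rewrite invr0 mulr_ge0 ?invr_ge0// ltW.
  have {}y0 : 0 < y by rewrite -(pmulr_rgt0 _ K0) (lt_le_trans x0).
  by rewrite ler_pdivlMr// mulrC ler_pdivrMr.
by move=> a0 b0 ab; split; apply: half => //; exact: within_factor_sym.
Qed.

(** Applied to the distances that make up an inversion weight of two finite
    points. *)
Lemma within_factor_weight K a b c a' b' c' : 0 < K ->
  0 <= a -> 0 <= b -> 0 <= c -> 0 <= a' -> 0 <= b' -> 0 <= c' ->
  within_factor K a a' -> within_factor K b b' -> within_factor K c c' ->
  within_factor (K ^+ 3) (a / (b * c)) (a' / (b' * c')).
Proof.
move=> K0 a0 b0 c0 a'0 b'0 c'0 aa' bb' cc'; rewrite exprS.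
apply: within_factorM; rewrite ?invr_ge0 ?mulr_ge0//.
apply: within_factorV; rewrite ?exprn_gt0 ?mulr_ge0//.
by rewrite expr2; exact: within_factorM.
Qed.

(** An inversion weight between a finite point and infinity is a mere inverse;
    weakening the factor to a power lets it share the bound of
    [within_factor_weight]. *)
Lemma within_factor_expV K n a b : 1 <= K -> 0 <= a -> 0 <= b -> (0 < n)%N ->
  within_factor K a b -> within_factor (K ^+ n) a^-1 b^-1.
Proof.
move=> K1 a0 b0 n0 ab; apply: (@within_factor_le K).
- by rewrite invr_ge0.
- by rewrite invr_ge0.
- by rewrite ler_eXnr.
- by apply: within_factorV => //; exact: lt_le_trans K1.
Qed.

End WithinFactor.

(** * Bi-Lipschitz maps *)

Section Bilipschitz.
Context (R : realType).
Implicit Types X Y Z : metricType R.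

Lemma bilipschitz_within_factor Y Z (K : R) (g : Y -> Z) x y : 1 <= K ->
  bilipschitz_homeo K g -> within_factor K (mdist x y) (mdist (g x) (g y)).
Proof.
move=> K1 [_ /(_ x y)[lo up]]; split=> //.
by rewrite -ler_pdivrMl// (lt_le_trans ltr01).
Qed.

Lemma bilipschitz_bijective Y Z (K : R) (g : Y -> Z) :
  bilipschitz_homeo K g -> bijective g.
Proof. by case=> [[_ [h [gK hK _]]] _]; exists h. Qed.

Lemma lipschitz_continuous Y Z (K : R) (f : Y -> Z) : 0 < K ->
  (forall x y, mdist (f x) (f y) <= K * mdist x y) -> continuous f.
Proof.
move=> K0 fK x; apply/cvg_ballP => e e0.
have eK : 0 < e / K by rewrite divr_gt0.
have := nbhsx_ballx x _ eK; apply: filterS => y.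
rewrite !ballEmdist/= => xy; apply: le_lt_trans (fK x y) _.
by rewrite mulrC -ltr_pdivlMr.
Qed.

Lemma bijective_bilipschitz Y Z (K : R) (f : Y -> Z) : 1 <= K ->
  bijective f ->
  (forall x y, within_factor K (mdist x y) (mdist (f x) (f y))) ->
  bilipschitz_homeo K f.
Proof.
move=> K1 [g gK fK] fd; have K0 : 0 < K by exact: lt_le_trans K1.
split.
  split; first by apply: lipschitz_continuous K0 _ => x y; case: (fd x y).
  exists g; split=> //; apply: lipschitz_continuous K0 _ => x y.
  by have [] := fd (g x) (g y); rewrite !fK.
by move=> x y; have [lo up] := fd x y; rewrite ler_pdivrMl.
Qed.

Lemma connected_dist_attained X (p a : X) (t : R) :
  connected [set: X] -> 0 <= t <= mdist a p -> exists q, mdist q p = t.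
Proof.
move=> Xc ta.
have cd : continuous (fun x : X => mdist x p : R^o).
  apply: (@lipschitz_continuous _ R^o 1) => // x y.
  rewrite mul1r [leLHS]/(`|mdist y p - mdist x p|) ler_norml.
  have := metric_triangle x y p; have := metric_triangle y x p.
  rewrite (metric_sym y x); lra.
have := connected_continuous_connected Xc (continuous_subspaceT cd).
move/connected_intervalP => /(_ 0 (mdist a p)).
case/(_ _ _ t ta).
- by exists p => //; rewrite mdistxx.
- by exists a.
- by move=> q _ <-; exists q.
Qed.

(** A weight between finite points involves three distances, each distorted by
    at most [K], whence the exponent. *)
Lemma inversion_weight_distortion Y Z (K : R) (g : Y -> Z) (o : Y) u v :
  1 <= K -> (forall x y, within_factor K (mdist x y) (mdist (g x) (g y))) ->
  within_factor (K ^+ 3) (inversion_weight o u v)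
    (inversion_weight (g o) (omap g u) (omap g v)).
Proof.
move=> K1 gK; have K0 : 0 < K by exact: lt_le_trans K1.
case: u v => [x|] [y|] /=; last by split; rewrite mulr0.
- by apply: within_factor_weight; rewrite ?mdist_ge0.
- by apply: within_factor_expV; rewrite ?mdist_ge0.
- by apply: within_factor_expV; rewrite ?mdist_ge0.
Qed.

Lemma mdist_neq0 X (x y : X) : x != y -> mdist x y != 0.
Proof. by move=> xy; rewrite gt_eqF// mdist_gt0. Qed.

End Bilipschitz.

(** * Inverting twice *)

Section Reinversion.
Context (R : realType) (X : metricType R) (p : X).
Local Notation Xp := (inversion p).

(** The point at infinity of the second inversion is the point [p] removed by
    the first. *)
Definition fill (u : option Xp) : option X := oapp val (Some p) u.
Definition unfill (z : option X) : option Xp := insub z.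

Lemma unfillK : cancel unfill fill.
Proof. by move=> z; rewrite /unfill /fill; case: insubP => //= /negPn/eqP. Qed.

Lemma fillK : cancel fill unfill.
Proof. by case=> [z|]; rewrite /unfill /fill/= ?valK// insubF// eqxx. Qed.

Lemma mdist_inversion (z w : Xp) :
  within_factor 4 (mdist z w) (inversion_weight p (val z) (val w)).
Proof.
have := inversion_dist_le z w; have := inversion_dist_ge z w.
have := inversion_weight_ge0 p (val z) (val w).
rewrite -[inversion_dist z w]/(mdist z w) /within_factor; lra.
Qed.

(** The weight of the second inversion, centred at [o], computed from the
    weight [i_p] instead of the metric of [X_p^*]. *)
Definition reinversion_weight (o z w : option X) : R :=
  let i := inversion_weight p in
  if z == Some p then if w == Some p then 0 else (i w o)^-1
  else if w == Some p then (i z o)^-1 else i z w / (i z o * i w o).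

Lemma inversion_weight_inversion (o : Xp) u v :
  within_factor (4 ^+ 3) (inversion_weight o u v)
    (reinversion_weight (val o) (fill u) (fill v)).
Proof.
rewrite /reinversion_weight.
have xp (x : Xp) : (val x == Some p) = false by exact: negbTE (valP x).
have ge1_4 : 1 <= 4 :> R by rewrite ler1n.
case: u v => [x|] [y|] /=; rewrite ?eqxx ?xp; last by split; rewrite mulr0.
- by apply: within_factor_weight;
    rewrite ?mdist_ge0 ?inversion_weight_ge0//; exact: mdist_inversion.
- by apply: within_factor_expV;
    rewrite ?mdist_ge0 ?inversion_weight_ge0//; exact: mdist_inversion.
- by apply: within_factor_expV;
    rewrite ?mdist_ge0 ?inversion_weight_ge0//; exact: mdist_inversion.
Qed.

Lemma reinversion_at_infty x y :
  reinversion_weight None (Some x) (Some y) = mdist x y.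
Proof.
rewrite /reinversion_weight !(inj_eq Some_inj).
have [->|xp] := eqVneq x p; have [->|yp] := eqVneq y p => /=;
  rewrite ?mdistxx ?invrK// 1?metric_sym//.
by field; rewrite !mdist_neq0.
Qed.

Lemma reinversion_at_point q z w : q != p ->
  reinversion_weight (Some q) z w = mdist q p ^+ 2 * inversion_weight q z w.
Proof.
move=> qp; rewrite /reinversion_weight.
have pq : mdist p q = mdist q p by exact: metric_sym.
(* When x or y is the centre q, both sides are 0 because inverses of 0 are. *)
case: z w => [x|] [y|] /=; rewrite ?(inj_eq Some_inj)//=.
- have [->|xp] := eqVneq x p; have [->|yp] := eqVneq y p => /=.
  + by rewrite mdistxx mul0r mulr0.
  + have [->|yq] := eqVneq y q; first by rewrite mdistxx !(mulr0,mul0r,invr0).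
    by rewrite pq (metric_sym p y); field; rewrite !mdist_neq0.
  + have [->|xq] := eqVneq x q; first by rewrite mdistxx !(mulr0,mul0r,invr0).
    by rewrite pq; field; rewrite !mdist_neq0.
  + have [->|xq] := eqVneq x q; first by rewrite mdistxx !(mulr0,mul0r,invr0).
    have [->|yq] := eqVneq y q; first by rewrite mdistxx !(mulr0,mul0r,invr0).
    by field; rewrite !mdist_neq0.
- have [->|xp] := eqVneq x p => /=.
    by rewrite pq; field; rewrite !mdist_neq0.
  have [->|xq] := eqVneq x q; first by rewrite mdistxx !(mulr0,mul0r,invr0).
  by field; rewrite !mdist_neq0.
- have [->|yp] := eqVneq y p => /=.
    by rewrite pq; field; rewrite !mdist_neq0.
  have [->|yq] := eqVneq y q; first by rewrite mdistxx !(mulr0,mul0r,invr0).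
  by field; rewrite !mdist_neq0.
- by rewrite mul0r mulr0.
Qed.

End Reinversion.

(** * Charts of the space by its inversion *)

Section Charts.
Context (R : realType) (X : metricType R) (p : X).

(** A bijection from [X] onto [X_p^*] that compares [d] with [r^2 i_p],
    extended to the one-point extensions by sending infinity to [p]; in this
    form charts are self-maps of one type and can be composed with inverses of
    each other. *)
Definition inversion_chart (K r : R) (F : option X -> option X) : Prop :=
  [/\ bijective F, F None = Some p & forall x y,
      within_factor K (mdist x y)
        (r ^+ 2 * inversion_weight p (F (Some x)) (F (Some y)))].

Lemma omap_bijective (Y Z : Type) (f : Y -> Z) :
  bijective f -> bijective (omap f).
Proof.
case=> g fK gK; exists (omap g) => - [x|] //=; first by rewrite fK.
by rewrite gK.
Qed.

(** The chart is [g], which takes infinity to [q] and fixes [p], followed by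
    [h], which takes [q] to [p] and fixes infinity. *)
Lemma inversion_chart_exists (L M : R) (q : X) (h : X -> X)
    (g : inversion p -> inversion p) (o : inversion p) :
  1 <= L -> 1 <= M -> q != p ->
  bilipschitz_homeo L h -> h q = p ->
  bilipschitz_homeo M g -> val o = None -> val (g o) = Some q ->
  exists F, inversion_chart (4 ^+ 3 * (M ^+ 3 * (4 ^+ 3 * L ^+ 3))) (mdist q p) F.
Proof.
move=> L1 M1 qp hb hq gb o_infty goq.
have L0 : 0 <= L by exact: le_trans L1.
have M0 : 0 <= M by exact: le_trans M1.
have hw u v : within_factor (L ^+ 3) (inversion_weight q u v)
    (inversion_weight p (omap h u) (omap h v)).
  rewrite -[p]hq; apply: inversion_weight_distortion => // z w.
  exact: bilipschitz_within_factor L1 hb.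
exists (omap h \o fill (p := p) \o omap g \o unfill p); split.
- apply: bij_comp; last by exists (@fill _ _ p); [exact: unfillK|exact: fillK].
  apply: bij_comp; last exact/omap_bijective/bilipschitz_bijective/gb.
  apply: bij_comp; first exact/omap_bijective/bilipschitz_bijective/hb.
  by exists (unfill p); [exact: fillK|exact: unfillK].
- have -> : None = val o by [].
  by rewrite /= /unfill valK/= goq/= hq.
- move=> x y /=.
  apply: (@within_factor_trans _ _ _ _
    (inversion_weight o (unfill p (Some x)) (unfill p (Some y)))).
  + by rewrite exprn_ge0.
  + by rewrite !mulr_ge0 ?exprn_ge0.
  + apply: within_factor_sym; rewrite -[mdist x y](reinversion_at_infty p).
    rewrite -o_infty -{2}(unfillK p (Some x)) -{2}(unfillK p (Some y)).
    exact: inversion_weight_inversion.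
  apply: within_factor_trans; [by rewrite exprn_ge0|by rewrite mulr_ge0 ?exprn_ge0| |].
    apply: (inversion_weight_distortion o _ _ M1) => z w.
    exact: bilipschitz_within_factor M1 gb.
  apply: within_factor_trans; [by rewrite exprn_ge0|by rewrite exprn_ge0| |].
    exact: inversion_weight_inversion.
  rewrite goq reinversion_at_point//.
  apply: within_factorZ; first by rewrite exprn_ge0// mdist_ge0.
  exact: hw.
Qed.

(** If [F1] and [F2] are the charts, the map is the inverse of [F1] after
    [F2]; both charts send infinity to [p], hence it preserves [X]. *)
Lemma inversion_charts_rescale (K r1 r2 : R) F1 F2 :
  0 <= K -> r2 != 0 ->
  inversion_chart K r1 F1 -> inversion_chart K r2 F2 ->
  exists2 f : X -> X, bijective f & forall x y,
    within_factor (K * K) ((r1 / r2) ^+ 2 * mdist x y) (mdist (f x) (f y)).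
Proof.
move=> K0 r20 [[G1 F1K G1K] F1p F1d] [[G2 F2K G2K] F2p F2d].
have finite (F G : option X -> option X) z : cancel F G -> F None = None ->
    Some (odflt p (F (Some z))) = F (Some z).
  by move=> FK F0; case E: (F _) => [//|]; have := FK (Some z); rewrite E -F0 FK.
have GF0 : G1 (F2 None) = None by rewrite F2p -F1p F1K.
have GF0' : G2 (F1 None) = None by rewrite F1p -F2p F2K.
have fE x : Some (odflt p (G1 (F2 (Some x)))) = G1 (F2 (Some x)).
  by apply: (finite (G1 \o F2) (G2 \o F1)) => // z /=; rewrite G1K F2K.
have gE x : Some (odflt p (G2 (F1 (Some x)))) = G2 (F1 (Some x)).
  by apply: (finite (G2 \o F1) (G1 \o F2)) => // z /=; rewrite G2K F1K.
exists (fun x => odflt p (G1 (F2 (Some x)))).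
  exists (fun x => odflt p (G2 (F1 (Some x)))) => x; apply: Some_inj.
    by rewrite gE fE G1K F2K.
  by rewrite fE gE G2K F1K.
move=> x y; apply: (within_factor_trans K0 K0 _ (within_factor_sym (F1d _ _))).
rewrite !fE !G1K.
have -> w : r1 ^+ 2 * w = (r1 / r2) ^+ 2 * (r2 ^+ 2 * w) by field.
by apply: (within_factorZ _ (F2d x y)); rewrite exprn_even_ge0.
Qed.

End Charts.

Theorem theorem2p7 (R : realType) (X : metricType R)
    (Xproper : proper_metric X)
    (Xconnected : connected [set: X])
    (Xhomogeneous : inversion_invariant_bilipschitz_homogeneous X) :
  quasi_self_similar X.
Proof.
case: Xhomogeneous => -[L L1 homX] [p [M M1 homXp]].
have L0 : 0 <= L by exact: le_trans L1.
have [[a ap]|/forallNP single] := pselect (exists a, a != p); last first.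
  have allp x : x = p by apply/eqP/negPn/negP; exact: single.
  exists 1 => //; exists p => s _; exists id => //.
  apply: bijective_bilipschitz => //; first by exists id.
  move=> x y; rewrite (allp x) (allp y) mdistxx.
  by rewrite [mdist _ _]mdistxx; split; rewrite mulr0.
pose K := 4 ^+ 3 * (M ^+ 3 * (4 ^+ 3 * L ^+ 3)).
have K1 : 1 <= K by rewrite !mulr_ege1 ?exprn_ege1 ?ler1n.
have K0 : 0 <= K by exact: le_trans K1.
have r0_gt0 : 0 < mdist a p by rewrite mdist_gt0.
have chart r : 0 < r <= mdist a p -> exists F, inversion_chart p K r F.
  move=> /andP[r_gt0 r_le].
  have [|q qr] := @connected_dist_attained _ _ p a r Xconnected.
    by rewrite ltW.
  have qp : q != p by rewrite -mdist_gt0 qr.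
  have [h hb hq] := homX q p.
  have qV : Some q != Some p by rewrite (inj_eq Some_inj).
  pose infty : inversion p := exist _ None isT.
  have [g gb g_infty] := homXp infty (exist _ (Some q) qV).
  rewrite -qr; apply: (inversion_chart_exists (o := infty) L1 M1 qp hb hq gb).
    by [].
  by rewrite g_infty.
clearbody K.
have KKL1 : 1 <= K * K * L by rewrite !mulr_ege1.
exists (K * K * L) => //; exists p => s s1.
have sqs : 1 <= Num.sqrt s%:num by rewrite -sqrtr1 ler_wsqrtr.
have sqs0 : 0 < Num.sqrt s%:num by exact: lt_le_trans sqs.
have [|F1 F1c] := chart (mdist a p); first by rewrite r0_gt0 lexx.
have [|F2 F2c] := chart (mdist a p / Num.sqrt s%:num).
  by rewrite divr_gt0//= ler_pdivrMr// ler_peMr// ltW.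
have [|f fbij fd] := inversion_charts_rescale K0 _ F1c F2c.
  by rewrite gt_eqF// divr_gt0.
have scale : (mdist a p / (mdist a p / Num.sqrt s%:num)) ^+ 2 = s%:num.
  by rewrite invf_div mulrC divfK ?gt_eqF// sqr_sqrtr.
have [k kb kfp] := homX (f p) p.
exists (k \o f) => //.
apply: bijective_bilipschitz => //.
  exact: bij_comp (bilipschitz_bijective kb) fbij.
move=> x y; apply: within_factor_trans; [by rewrite mulr_ge0|exact: L0| |].
  by rewrite -[mdist x y]/(s%:num * mdist (x : X) (y : X)) -scale; exact: fd.
exact: bilipschitz_within_factor L1 kb.
Qed.
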